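(* Let $(M,F)$ be an $m$-th root metric space with polynomial flag metric $h_{ij}=a_{ij i_3\dots i_m}(x)y^{i_3}\cdots y^{i_m}$. Then $(M,F)$ is of Landsberg type if and only if, with respect to the horizontal covariant derivative $|$ of the Berwald connection $B\Gamma(N)$ of $(M,F)$, $$h_{ij|k}=0,\qquad i,j,k=1,\dots,n.$$
   Context: Let $M$ be a smooth $n$-dimensional manifold with induced coordinates $(x^i,y^i)$ on $TM$. An $m$-th root metric space ($m\ge 2$) is $(M,F)$ with $F=\sqrt[m]{a_{i_1\dots i_m}(x)y^{i_1}\cdots y^{i_m}}$, where $a_{i_1\dots i_m}$ is totally symmetric and $g_{ij}=\frac12\frac{\partial^2F^2}{\partial y^i\partial y^j}$ is nondegenerate on $TM\setminus\{0\}$ (at the points where $F$ is defined and smooth); $g$ may have arbitrary signature. Then the matrix $(h_{ij})$ is also nondegenerate; $(h^{ij})$ denotes its inverse. Set $\gamma_{p\,j_1\dots j_m}=\frac1{m(m-1)}\Big(\sum_{(j_1,\dots,j_m)}\frac{\partial a_{pj_2\dots j_m}}{\partial x^{j_1}}-\frac{\partial a_{j_1\dots j_m}}{\partial x^p}\Big)$, where $\sum_{(j_1,\dots,j_m)}$ is the cyclic sum. The canonical spray coefficients are $G^i=\frac12h^{ip}\gamma_{p\,j_1\dots j_m}y^{j_1}\cdots y^{j_m}$ (the usual Finsler spray of $F$, with geodesics $\ddot x^i+2G^i(x,\dot x)=0$). The canonical nonlinear connection is $N^i_{\ j}=\partial G^i/\partial y^j$, with $\frac{\delta}{\delta x^l}=\frac{\partial}{\partial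 x^l}-N^r_{\ l}\frac{\partial}{\partial y^r}$. The Berwald connection $B\Gamma(N)$ has horizontal coefficients $G^i_{\ jk}=\frac{\partial^2G^i}{\partial y^j\partial y^k}$. The horizontal covariant derivative of a tensor $t_{ij}(x,y)$ with respect to it is $t_{ij|k}=\frac{\delta t_{ij}}{\delta x^k}-G^r_{\ ik}t_{rj}-G^r_{\ jk}t_{ir}$. A Finsler space is a Landsberg space (of Landsberg type) if its Berwald connection is $h$-metrical, i.e. $g_{ij|k}=0$ with respect to $B\Gamma(N)$. *)

(* Defs.v *)
(* MathComp world (MathComp-Analysis); the reals are an arbitrary realType R. *)
From HB Require Import structures.
From mathcomp Require Import all_boot all_order all_algebra.
From mathcomp Require Import all_classical all_reals all_analysis.

Set Implicit Arguments.
Unset Strict Implicit.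
Unset Printing Implicit Defensive.

Import Order.TTheory GRing.Theory Num.Theory.
Import numFieldNormedType.Exports.

Local Open Scope classical_set_scope.
Local Open Scope ring_scope.

Section Coordinates.
Variables (R : realType) (n : nat).
Implicit Types (U : set 'rV[R]_n) (f : 'rV[R]_n -> R) (x y : 'rV[R]_n).

Definition pderiv (i : 'I_n) f x : R := 'D_(delta_mx 0 i) f x.

Fixpoint class_C (k : nat) U f : Prop :=
  {in U, continuous f} /\
  if k is k'.+1 then
    forall i : 'I_n, (forall x, U x -> derivable f x (delta_mx 0 i)) /\
                     class_C k' U (pderiv i f)
  else True.

(* Only used for open U, where the partial derivatives at a point of U depend
   on the values of f on U alone. *)
Definition smooth_on U f : Prop := forall k, class_C k U f.

End Coordinates.

Section Manifold.
Variables (R : realType) (n : nat).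

Record chart (M : topologicalType) := Chart {
  chart_dom : set M;
  chart_map : M -> 'rV[R]_n;
  chart_inv : 'rV[R]_n -> M;
  chart_dom_open : open chart_dom;
  chart_img_open : open (chart_map @` chart_dom);
  chart_mapK : {in chart_dom, cancel chart_map chart_inv};
  chart_map_cts : {in chart_dom, continuous chart_map};
  chart_inv_cts : {in chart_map @` chart_dom, continuous chart_inv} }.

Definition chart_img (M : topologicalType) (c : chart M) : set 'rV[R]_n :=
  chart_map c @` chart_dom c.

Definition transition (M : topologicalType) (c d : chart M) :
    'rV[R]_n -> 'rV[R]_n := chart_map d \o chart_inv c.

(* A smooth manifold is given with an atlas, not necessarily a maximal one. *)
Record smoothManifold := SmoothManifold {
  carrier :> topologicalType;
  carrier_hausdorff : hausdorff_space carrier;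
  carrier_second_countable : @second_countable carrier;
  chart_index : Type;
  atlas : chart_index -> chart carrier;
  atlas_cover : forall p : carrier, exists c, chart_dom (atlas c) p;
  atlas_compat : forall (c d : chart_index) (i : 'I_n),
    smooth_on
      (chart_map (atlas c) @` (chart_dom (atlas c) `&` chart_dom (atlas d)))
      (fun x => transition (atlas c) (atlas d) x 0 i) }.

End Manifold.

(* The objects attached to an m-th root metric in one coordinate system.
   [a x s] is the component a_{s_1...s_m}(x), where s lists the m indices; the
   values of [a x] on lists of another length are never used. A point of TM has
   coordinates (x, y), and functions on TM are curried. *)
Section MthRoot.
Variables (R : realType) (n m : nat) (a : 'rV[R]_n -> seq 'I_n -> R).
Implicit Types (x y : 'rV[R]_n) (i j k l p : 'I_n).

Definition mform x y : R :=
  \sum_(J : m.-tuple 'I_n) a x J * \prod_(j <- J) y 0 j.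

(* The real m-th root: the nonnegative root of t >= 0, and -|t|^(1/m) for t < 0
   (which is a root only for odd m). *)
Definition mroot (t : R) : R := Num.sg t * `|t| `^ (m%:R^-1).

Definition mrootF x y : R := mroot (mform x y).

(* The points of the slit tangent bundle at which F is defined and smooth. Points
   with F = 0 are left out: if F were smooth there, g = F F_ij + F_i F_j would
   have rank at most 1 and satisfy g(y, y) = F^2 = 0, hence be degenerate. *)
Definition regular x y : Prop :=
  y != 0 /\ (if odd m then mform x y != 0 else 0 < mform x y).

Definition gmetric x y : 'M[R]_n :=
  \matrix_(i, j) (2^-1 * pderiv i (pderiv j (fun z => mrootF x z ^+ 2)) y).

Definition hmetric x y : 'M[R]_n :=
  \matrix_(i, j) \sum_(J : (m - 2).-tuple 'I_n)
    a x [:: i, j & J] * \prod_(l <- J) y 0 l.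

(* rot k J starts with j_{k+1}, so the inner sum is the cyclic sum over
   (j_1, ..., j_m) of the derivatives of a_{p j_2...j_m} along x^{j_1}. *)
Definition gamma p (J : m.-tuple 'I_n) x : R :=
  (m%:R * (m - 1)%:R)^-1 *
  (\sum_(k < m) pderiv (tnth J k) (fun z => a z (p :: behead (rot k J))) x
   - pderiv p (fun z => a z J) x).

Definition spray i x y : R :=
  2^-1 * \sum_p invmx (hmetric x y) i p *
    \sum_(J : m.-tuple 'I_n) gamma p J x * \prod_(j <- J) y 0 j.

Definition nonlinear_connection i j x y : R := pderiv j (spray i x) y.

Definition delta_deriv l (t : 'rV[R]_n -> 'rV[R]_n -> R) x y : R :=
  pderiv l (fun z => t z y) x
  - \sum_r nonlinear_connection r l x y * pderiv r (t x) y.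

Definition berwald i j k x y : R := pderiv j (pderiv k (spray i x)) y.

(* t_{ij|k} *)
Definition hcov (t : 'rV[R]_n -> 'rV[R]_n -> 'M[R]_n) i j k x y : R :=
  delta_deriv k (fun z w => t z w i j) x y
  - \sum_r berwald r i k x y * t x y r j
  - \sum_r berwald r j k x y * t x y i r.

End MthRoot.

Section MthRootSpace.
Variables (R : realType) (n m : nat) (M : smoothManifold R n).

Record mthRootSpace := MthRootSpace {
  coef : chart_index M -> 'rV[R]_n -> seq 'I_n -> R;
  coef_smooth : forall c (s : m.-tuple 'I_n),
    smooth_on (chart_img (atlas c)) (fun x => coef c x s);
  coef_sym : forall c x (s t : m.-tuple 'I_n),
    chart_img (atlas c) x -> perm_eq s t -> coef c x s = coef c x t;
  (* a is a covariant tensor of order m *)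
  coef_tensor : forall c d (q : M) (s : m.-tuple 'I_n),
    chart_dom (atlas c) q -> chart_dom (atlas d) q ->
    coef c (chart_map (atlas c) q) s =
    \sum_(t : m.-tuple 'I_n)
      coef d (chart_map (atlas d) q) t *
      \prod_(k < m) pderiv (tnth s k)
        (fun x => transition (atlas c) (atlas d) x 0 (tnth t k))
        (chart_map (atlas c) q);
  g_nondegenerate : forall c x y,
    chart_img (atlas c) x -> regular m (coef c) x y ->
    gmetric m (coef c) x y \in unitmx }.

Variable S : mthRootSpace.

(* The tensor field on TM with components [t c] in the chart c is h-parallel for
   the Berwald connection. *)
Definition berwald_parallel
    (t : chart_index M -> 'rV[R]_n -> 'rV[R]_n -> 'M[R]_n) : Prop :=
  forall c x y, chart_img (atlas c) x -> regular m (coef S c) x y ->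
    forall i j k : 'I_n, hcov m (coef S c) (t c) i j k x y = 0.

Definition landsberg : Prop :=
  berwald_parallel (fun c => gmetric m (coef S c)).

End MthRootSpace.

(* Main.v *)
Require Import Defs.
From HB Require Import structures.
From mathcomp Require Import all_boot all_order all_algebra.
From mathcomp Require Import all_classical all_reals all_analysis.
From mathcomp Require Import ring.

(* Write A = F^m, a homogeneous polynomial in y with y-gradient m h_i, where
   h_i = h_ij y^j. The spray equation contracted with y reads
   2 G^r h_r = m^-1 y^j dA/dx^j; differentiating it in y gives delta_l A = 0,
   and once more h_{i|l} = 0. Off the zeros of F,
   g_ij = (m-1) F^(2-m) h_ij - (m-2) F^(2-2m) h_i h_j,
   hence g_{ij|k} = (m-1) F^(2-m) h_{ij|k}. The same formula factors g through h
   as a product of matrices, so that h is invertible and the spray is smooth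
   in y. *)

Set Implicit Arguments.
Unset Strict Implicit.
Unset Printing Implicit Defensive.

Import Order.TTheory GRing.Theory Num.Theory.
Import numFieldNormedType.Exports.

Local Open Scope classical_set_scope.
Local Open Scope ring_scope.

(** * Local equality of functions and directional derivatives *)

Lemma continuous_eq_in (T S : topologicalType) (U : set T) (f g : T -> S) :
  open U -> {in U, f =1 g} -> {in U, continuous f} -> {in U, continuous g}.
Proof.
move=> oU fg cf x Ux; rewrite /continuous_at -(fg x Ux).
apply: cvg_trans (cf x Ux); apply: near_eq_cvg.
have := open_nbhs_nbhs (conj oU (set_mem Ux)).
by apply: filterS => y Uy; exact/fg/mem_set.
Qed.

Section DirectionalDerivative.
Variables (R : realType) (V : normedModType R).
Implicit Types (f g : V -> R) (x v : V).

Lemma is_derive_add f g x v df dg : is_derive x v f df -> is_derive x v g dg ->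
  is_derive x v (fun y => f y + g y) (df + dg).
Proof. exact: is_deriveD. Qed.

Lemma is_derive_mul f g x v df dg : is_derive x v f df -> is_derive x v g dg ->
  is_derive x v (fun y => f y * g y) (f x * dg + g x * df).
Proof. exact: is_deriveM. Qed.

Lemma is_derive_scale (c : R) f x v df : is_derive x v f df ->
  is_derive x v (fun y => c * f y) (c * df).
Proof. exact: is_deriveZ. Qed.

Lemma is_derive_inv f x v df : f x != 0 -> is_derive x v f df ->
  is_derive x v (fun y => (f y)^-1) (- f x ^- 2 * df).
Proof.
move=> fx0 [fxv <-]; split; first exact: derivableV.
exact: deriveV.
Qed.

Lemma is_derive_bigsum (I : Type) (r : seq I) (P : pred I) (f : I -> V -> R)
    (df : I -> R) x v : (forall i, is_derive x v (f i) (df i)) ->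
  is_derive x v (fun y => \sum_(i <- r | P i) f i y) (\sum_(i <- r | P i) df i).
Proof.
move=> fi; elim: r => [|i r IHr].
  under eq_fun do rewrite big_nil.
  by rewrite big_nil; exact: is_derive_cst.
under eq_fun do rewrite big_cons.
by rewrite big_cons; case: (P i) => //; exact: is_derive_add.
Qed.

(** Only the derivative of [f] along [v] is given, so [f] is restricted to the line h -> h v + x,
    where the one-variable chain rule applies. *)
Lemma is_derive_chain (phi : R -> R) f x v a df :
  is_derive (f x) 1 phi a -> is_derive x v f df ->
  is_derive x v (fun y => phi (f y)) (a * df).
Proof.
move=> phia fd.
pose F h := f (h *: v + x).
(* The difference quotient of [p] at [x] along [v] is that of its restriction to the line at 0, so
   the two derivatives exist together and agree. *)
have line (p : V -> R) : (fun h : R => h^-1 *: (p (h *: v + x) - p x))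
    = (fun h : R => h^-1 *:
        (p ((h *: (1 : R) + 0 : R) *: v + x) - p ((0 : R) *: v + x))).
  by apply: funext => h; rewrite addr0 scale0r add0r [h *: (1 : R)]mulr1.
have lineP (p : V -> R) d :
    is_derive x v p d <-> is_derive (0 : R) 1 (fun h => p (h *: v + x)) d.
  by split=> -[]; split; move: ex_derive derive_val;
    rewrite /derivable /derive /= line.
apply/lineP; apply: (@is_derive1_comp _ phi F); last exact/lineP.
by rewrite /F scale0r add0r.
Qed.

End DirectionalDerivative.

(** * Partial derivatives and C^k functions on open sets *)

Section PartialDerivative.
Variables (R : realType) (n : nat).
Implicit Types (f g : 'rV[R]_n -> R) (x : 'rV[R]_n) (U : set 'rV[R]_n).

Lemma is_derive_coord (x v : 'rV[R]_n) j :
  is_derive x v (fun y : 'rV[R]_n => y 0 j) (v 0 j).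
Proof.
have cv : h^-1 *: ((h *: v + x) 0 j - x 0 j) @[h --> (0 : R)^'] --> v 0 j.
  apply: (@cvg_trans _ (v 0 j @[h --> (0 : R)^'])); last exact: cvg_cst.
  apply: near_eq_cvg; near=> h.
  rewrite !mxE addrK [_ *: _]mulrA mulVf ?mul1r//.
  by near: h; exact: nbhs_dnbhs_neq.
by split; [apply/cvg_ex; exists (v 0 j) | exact: cvg_lim].
Unshelve. all: by end_near. Qed.

Lemma near_eq_in U f g x : open U -> {in U, f =1 g} -> U x ->
  {near x, f =1 g}.
Proof.
move=> oU fg Ux; have := open_nbhs_nbhs (conj oU Ux).
by apply: filterS => y Uy; exact/fg/mem_set.
Qed.

Lemma pderiv_eq U f g i x : open U -> {in U, f =1 g} -> U x ->
  pderiv i f x = pderiv i g x.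
Proof. by move=> oU fg Ux; exact/near_eq_derive/(near_eq_in oU). Qed.

Lemma is_derive_eq_in U f g x v d : open U -> {in U, f =1 g} -> U x ->
  is_derive x v f d -> is_derive x v g d.
Proof. by move=> oU fg Ux; exact/near_eq_is_derive/(near_eq_in oU). Qed.

(** The formulas for derivatives of sums, products and inverses hold on [U] only. Since [U] is open,
    functions equal on [U] have equal partial derivatives there, so the regularity of one passes to
    the other at each order. *)
Lemma class_C_eq k U f g : open U -> {in U, f =1 g} ->
  class_C k U f -> class_C k U g.
Proof.
move=> oU; elim: k f g => [|k IHk] f g fg [cf df]; split=> //;
  try exact: continuous_eq_in cf.
move=> i; have [dfi cfi] := df i; split=> [x Ux|].
  by have [] := is_derive_eq_in oU fg Ux (derivableP (dfi x Ux)).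
apply: IHk cfi => x /set_mem Ux; exact: pderiv_eq oU fg Ux.
Qed.

Lemma class_C_pred k U f : class_C k.+1 U f -> class_C k U f.
Proof.
elim: k f => [|k IHk] f [cf df]; split=> // i.
by have [dfi cfi] := df i; split=> //; exact: IHk.
Qed.

Lemma class_C_cst k U (c : R) : class_C k U (fun=> c).
Proof.
elim: k c => [|k IHk] c; split=> //; try by move=> x _; exact: cst_continuous.
move=> i; split=> [x _|]; first exact: derivable_cst.
rewrite (_ : pderiv i _ = fun=> 0) //.
by apply: funext => x; exact: derive_cst.
Qed.

Lemma class_C_add k U f g : open U -> class_C k U f -> class_C k U g ->
  class_C k U (fun x => f x + g x).
Proof.
move=> oU; elim: k f g => [|k IHk] f g [cf df] [cg dg]; split=> //;
  try by move=> x Ux; apply: continuousD; [exact: cf|exact: cg].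
move=> i; have [dfi cfi] := df i; have [dgi cgi] := dg i.
have D x : U x -> is_derive x (delta_mx 0 i) (fun x => f x + g x)
    (pderiv i f x + pderiv i g x).
  move=> Ux.
  by apply: is_derive_add; apply: derivableP; [exact: dfi|exact: dgi].
split=> [x Ux|]; first by have [] := D x Ux.
apply: class_C_eq (IHk _ _ cfi cgi) => // x /set_mem Ux.
by have [_ <-] := D x Ux.
Qed.

Lemma class_C_mul k U f g : open U -> class_C k U f -> class_C k U g ->
  class_C k U (fun x => f x * g x).
Proof.
move=> oU; elim: k f g => [|k IHk] f g; [move=> [cf df] [cg dg]|
  move=> Cf Cg; have [cf df] := Cf; have [cg dg] := Cg]; split=> //;
  try by move=> x Ux; apply: continuousM; [exact: cf|exact: cg].
move=> i; have [dfi cfi] := df i; have [dgi cgi] := dg i.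
have D x : U x -> is_derive x (delta_mx 0 i) (fun x => f x * g x)
    (f x * pderiv i g x + g x * pderiv i f x).
  move=> Ux.
  by apply: is_derive_mul; apply: derivableP; [exact: dfi|exact: dgi].
split=> [x Ux|]; first by have [] := D x Ux.
(* The product rule keeps [f] and [g] undifferentiated, so they are lowered from order k+1 to k
   before the induction hypothesis applies. *)
have C : class_C k U (fun x => f x * pderiv i g x + g x * pderiv i f x).
  by apply: class_C_add => //; apply: IHk => //; exact: class_C_pred.
by apply: class_C_eq C => // x /set_mem Ux; have [_ <-] := D x Ux.
Qed.

Lemma class_C_inv k U f : open U -> (forall x, U x -> f x != 0) ->
  class_C k U f -> class_C k U (fun x => (f x)^-1).
Proof.
move=> oU f0; elim: k => [|k IHk] Cf; have [cf df] := Cf; split=> //;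
  try by move=> x Ux; apply: continuousV; [exact/f0/set_mem|exact: cf].
move=> i; have [dfi cfi] := df i.
have D x : U x -> is_derive x (delta_mx 0 i) (fun x => (f x)^-1)
    (- f x ^- 2 * pderiv i f x).
  by move=> Ux; apply: is_derive_inv; [exact: f0|apply: derivableP; exact: dfi].
split=> [x Ux|]; first by have [] := D x Ux.
(* The derivative of 1/f is -(1/f)^2 f', so the induction hypothesis on 1/f itself gives the next
   order. *)
have Cv := IHk (class_C_pred Cf).
have C := class_C_mul oU (class_C_mul oU (class_C_cst k U (-1))
  (class_C_mul oU Cv Cv)) cfi.
apply: class_C_eq C => // x /set_mem Ux; rewrite /pderiv; have [_ ->] := D x Ux.
by rewrite mulN1r expr2 invfM.
Qed.

Lemma class_C_bigsum (I : Type) k (r : seq I) (P : pred I)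
    (f : I -> 'rV[R]_n -> R) U : open U -> (forall i, class_C k U (f i)) ->
  class_C k U (fun x => \sum_(i <- r | P i) f i x).
Proof.
move=> oU Cf; elim: r => [|i r IHr].
  by under eq_fun do rewrite big_nil; exact: class_C_cst.
under eq_fun do rewrite big_cons.
by case: (P i) => //; exact: class_C_add.
Qed.

Lemma class_C_bigprod (I : Type) k (r : seq I) (P : pred I)
    (f : I -> 'rV[R]_n -> R) U : open U -> (forall i, class_C k U (f i)) ->
  class_C k U (fun x => \prod_(i <- r | P i) f i x).
Proof.
move=> oU Cf; elim: r => [|i r IHr].
  by under eq_fun do rewrite big_nil; exact: class_C_cst.
under eq_fun do rewrite big_cons.
by case: (P i) => //; exact: class_C_mul.
Qed.

Lemma class_C_coord k U (j : 'I_n) : class_C k U (fun y => y 0 j).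
Proof.
case: k => [|k]; split=> //; try by move=> x _; exact: coord_continuous.
move=> i; split=> [x _|].
  by have [] := is_derive_coord x (delta_mx 0 i) j.
rewrite (_ : pderiv i _ = fun=> (delta_mx 0 i : 'rV[R]_n) 0 j).
  exact: class_C_cst.
by apply: funext => x; have [_] := is_derive_coord x (delta_mx 0 i) j.
Qed.

Lemma class_C_det k U p (A : 'rV[R]_n -> 'M[R]_p) : open U ->
  (forall i j, class_C k U (fun y => A y i j)) ->
  class_C k U (fun y => \det (A y)).
Proof.
move=> oU CA; apply: class_C_bigsum => // s.
apply: class_C_mul => //; first exact: class_C_cst.
exact: class_C_bigprod.
Qed.

(** Cramer's rule: each entry is a cofactor divided by the determinant. [invmx] follows this formula
    only at invertible matrices, hence the comparison on [U]. *)
Lemma class_C_invmx k U p (A : 'rV[R]_n -> 'M[R]_p) i j : open U ->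
  (forall y, U y -> A y \in unitmx) ->
  (forall i j, class_C k U (fun y => A y i j)) ->
  class_C k U (fun y => invmx (A y) i j).
Proof.
move=> oU uA CA.
have C : class_C k U (fun y => (\det (A y))^-1 *
    ((-1) ^+ (j + i) * \det (row' j (col' i (A y))))).
  apply: class_C_mul => //.
    apply: class_C_inv => //; last exact: class_C_det.
    by move=> x /uA; rewrite unitmxE unitfE.
  apply: class_C_mul => //; first exact: class_C_cst.
  apply: class_C_det => // r s; rewrite (_ : (fun y => _) =
    fun y => A y (lift j r) (lift i s)) //.
  by apply: funext => y; rewrite !mxE.
apply: class_C_eq C => // y /set_mem /uA Ay.
by rewrite /invmx Ay !mxE.
Qed.

End PartialDerivative.

(** * Homogeneous polynomials with symmetric coefficients *)

Section Forms.
Variables (R : realType) (n : nat).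
Implicit Types (b : seq 'I_n -> R) (x y v : 'rV[R]_n) (k : nat).

Lemma big_tupleS k (F : seq 'I_n -> R) :
  \sum_(J : k.+1.-tuple 'I_n) F J =
  \sum_(i < n) \sum_(J : k.-tuple 'I_n) F (i :: J).
Proof.
rewrite pair_bigA /=.
rewrite (reindex (fun p : 'I_n * k.-tuple 'I_n => cons_tuple p.1 p.2)) //=.
exists (fun J : k.+1.-tuple 'I_n => (thead J, [tuple of behead J])).
  by move=> [i J] _ /=; rewrite theadE; congr pair; exact: val_inj.
by move=> J _ /=; rewrite [RHS]tuple_eta; exact: val_inj.
Qed.

Lemma sum_delta_mx i (f : 'I_n -> R) :
  \sum_j (delta_mx 0 i : 'rV[R]_n) 0 j * f j = f i.
Proof.
rewrite (bigD1 i)//= mxE !eqxx mul1r big1 ?addr0// => j ji.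
by rewrite mxE (negbTE ji) andbF mul0r.
Qed.

(** Coefficients are functions of lists, so fixing leading indices is composition with [cons]; one
    definition then covers F^m, h_i and h_ij. *)
Definition pform b k y : R :=
  \sum_(J : k.-tuple 'I_n) b J * \prod_(j <- J) y 0 j.

Definition form_sym b k :=
  forall s t, size s = k -> perm_eq s t -> b s = b t.

Lemma form_sym_cons b k i : form_sym b k.+1 -> form_sym (b \o cons i) k.
Proof. by move=> bS s t sk st; apply: bS; rewrite /= ?sk// perm_cons. Qed.

Lemma eq_pform b b' k y : (forall J : k.-tuple 'I_n, b J = b' J) ->
  pform b k y = pform b' k y.
Proof. by move=> bb'; apply: eq_bigr => J _; rewrite bb'. Qed.

Lemma pformS b k y :
  pform b k.+1 y = \sum_i y 0 i * pform (b \o cons i) k y.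
Proof.
rewrite /pform (big_tupleS k (fun J => b J * \prod_(j <- J) y 0 j)).
apply: eq_bigr => i _; rewrite mulr_sumr; apply: eq_bigr => J _ /=.
by rewrite big_cons mulrCA.
Qed.

Lemma pform_swap b k i j y : form_sym b k.+2 ->
  pform (b \o cons i \o cons j) k y = pform (b \o cons j \o cons i) k y.
Proof.
move=> bS; apply: eq_pform => J /=; apply: bS; first by rewrite /= size_tuple.
by rewrite -[[:: i, j & J]]/([:: i] ++ [:: j] ++ J) perm_catCA.
Qed.

(** Induction on the degree: one factor y^i is split off and the product rule applied. Symmetry
    moves the differentiated index past the index split off. *)
Lemma is_derive_pform b k y v : form_sym b k.+1 ->
  is_derive y v (pform b k.+1)
    (k.+1%:R * \sum_i v 0 i * pform (b \o cons i) k y).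
Proof.
elim: k b => [|k IHk] b bS; rewrite (funext (pformS b _)).
  have D i : is_derive y v
      (fun y => y 0 i * pform (b \o cons i) 0 y)
      (v 0 i * pform (b \o cons i) 0 y).
    have c w : pform (b \o cons i) 0 w = b [:: i].
      rewrite /pform (big_pred1 [tuple]) ?big_nil ?mulr1//.
      by move=> J; exact/esym/eqP/tuple0.
    rewrite c; under eq_fun do rewrite c mulrC.
    by rewrite mulrC; apply: is_derive_scale; exact: is_derive_coord.
  by rewrite mul1r; exact: is_derive_bigsum.
have D i := is_derive_mul (is_derive_coord y v i)
  (IHk _ (@form_sym_cons _ _ i bS)).
apply: is_derive_eq (is_derive_bigsum _ _ D) _.
(* Differentiating y^i gives one copy of the sum; the induction hypothesis gives the other k+1. *)
rewrite big_split /= addrC -[k.+2]addn1 addnC natrD mulrDl mul1r; congr (_ + _).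
  by apply: eq_bigr => i _; rewrite mulrC.
under eq_bigr do rewrite mulrCA mulr_sumr.
rewrite -mulr_sumr exchange_big; congr (_ * _); apply: eq_bigr => i _ /=.
rewrite pformS mulr_sumr; apply: eq_bigr => j _; rewrite mulrCA.
by congr (_ * (_ * _)); exact: pform_swap.
Qed.

Lemma is_derive_pform_delta b k y i : form_sym b k.+1 ->
  is_derive y (delta_mx 0 i) (pform b k.+1)
    (k.+1%:R * pform (b \o cons i) k y).
Proof.
move=> bS; apply: is_derive_eq (is_derive_pform _ _ bS) _.
by rewrite sum_delta_mx.
Qed.

Lemma is_derive_pform_coef (c : 'rV[R]_n -> seq 'I_n -> R)
    (d : seq 'I_n -> R) k x v y :
  (forall J : k.-tuple 'I_n, is_derive x v (c^~ J) (d J)) ->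
  is_derive x v (fun z => pform (c z) k y) (pform d k y).
Proof.
move=> cd; apply: is_derive_bigsum => J.
rewrite mulrC; under eq_fun do rewrite mulrC.
exact: is_derive_scale.
Qed.

Lemma class_C_pform b k l U : open U -> class_C l U (pform b k).
Proof.
move=> oU; apply: class_C_bigsum => // J; apply: class_C_mul => //.
  exact: class_C_cst.
by apply: class_C_bigprod => // j; exact: class_C_coord.
Qed.

End Forms.

(** * Derivatives of the squared real root *)

Section RootOfForm.
Variables (R : realType) (m : nat).
Implicit Types t : R.

Lemma mroot_neq0 t : t != 0 -> mroot m t != 0.
Proof.
move=> t0; rewrite mulf_neq0// ?sgr_eq0//.
by rewrite gt_eqF// powR_gt0// normr_gt0.
Qed.

Lemma mrootN t : mroot m (- t) = - mroot m t.
Proof. by rewrite /mroot sgrN normrN mulNr. Qed.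

Lemma is_derive_mroot_sqr t : t != 0 ->
  is_derive t 1 (fun s => mroot m s ^+ 2)
    (2 / m%:R * (mroot m t ^+ 2 / t)).
Proof.
(* On the positive half-line the squared root is a real power, so the power rule applies. *)
have pos (s : R) : 0 < s -> mroot m s ^+ 2 = s `^ (2 / m%:R).
  move=> s0; rewrite /mroot gtr0_sg// mul1r gtr0_norm// -powR_mulrn ?powR_ge0//.
  by rewrite -powRrM mulrC.
have posD (s : R) : 0 < s -> is_derive s 1 (fun s => mroot m s ^+ 2)
    (2 / m%:R * (mroot m s ^+ 2 / s)).
  move=> s0; have D : is_derive s 1 (fun u : R => u `^ (2 / m%:R))
      (2 / m%:R * (mroot m s ^+ 2 / s)).
    apply: is_derive_eq (is_derive1_powR _ s0) _.
    rewrite powRB ?powRr1 ?pos ?ltW//.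
    by rewrite (gt_eqF s0) implybT.
  apply: near_eq_is_derive D.
  by near=> u; rewrite pos//; near: u; exact: lt_nbhsr.
rewrite neq_lt => /orP[t0|]; last exact: posD.
have Nt0 : 0 < - t by rewrite oppr_gt0.
(* The signed root is odd, so its square is even, and the negative case follows by composing with s
   -> -s. *)
rewrite (_ : (fun s => _) = (fun s => mroot m (- s) ^+ 2)); last first.
  by apply: funext => s; rewrite mrootN sqrrN.
apply: is_derive_eq (is_derive_chain (posD _ Nt0) (is_deriveNid _ _)) _.
by rewrite mrootN sqrrN invrN; ring.
Unshelve. all: by end_near. Qed.

Lemma is_derive_mroot_sqr_div t : (0 < m)%N -> t != 0 ->
  is_derive t 1 (fun s => mroot m s ^+ 2 / s)
    ((2 / m%:R - 1) * (mroot m t ^+ 2 / t / t)).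
Proof.
move=> m_gt0 t0.
have D := is_derive_mul (is_derive_mroot_sqr t0)
  (is_derive_inv t0 (is_derive_id t 1)).
apply: is_derive_eq D _; field.
by rewrite t0 pnatr_eq0 -lt0n m_gt0.
Qed.

Lemma derivable_mroot_sqr_div2 t : (0 < m)%N -> t != 0 ->
  derivable (fun s => mroot m s ^+ 2 / s / s) t 1.
Proof.
move=> m_gt0 t0; have [D _] := is_derive_mul (is_derive_mroot_sqr_div m_gt0 t0)
  (is_derive_inv t0 (is_derive_id t 1)).
exact: D.
Qed.

End RootOfForm.

(** * Algebra of the covariant derivative of g *)

Section MetricAlgebra.
Variable R : realType.

(** Applied with f = F^m, p = h_i, q = h_j and h = h_ij, once in x and once in y: the coefficients
    of [df], [dp], [dq], [dh] are the same in both, so the derivatives can be recombined into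
    covariant ones. *)
Lemma derive_metric (V : normedModType R) (e c : R) (chi psi : R -> R)
    (f p q h g : V -> R) (z v : V) (df dp dq dh : R) :
  (\near z, e * chi (f z) * (p z * q z) + c * psi (f z) * h z = g z) ->
  derivable chi (f z) 1 -> derivable psi (f z) 1 ->
  is_derive z v f df -> is_derive z v p dp -> is_derive z v q dq ->
  is_derive z v h dh ->
  'D_v g z =
    ((e * 'D_1 chi (f z) * (p z * q z) + c * 'D_1 psi (f z) * h z) * df +
     e * chi (f z) * q z * dp + e * chi (f z) * p z * dq +
     c * psi (f z) * dh).
Proof.
move=> /near_eq_derive <- /derivableP Dchi /derivableP Dpsi Df Dp Dq Dh.
have D := is_derive_add
  (is_derive_mul (is_derive_scale e (is_derive_chain Dchi Df))
    (is_derive_mul Dp Dq))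
  (is_derive_mul (is_derive_scale c (is_derive_chain Dpsi Df)) Dh).
have [_ ->] := D.
by move: ('D_1 chi _) ('D_1 psi _) => dchi dpsi; ring.
Qed.

(** Here [N] is the nonlinear connection, [s] and [t] are Berwald coefficients and [u] is h_r. The
    three hypotheses say that F^m, h_i and h_j have zero horizontal derivative, so only the multiple
    [c4] of h_{ij|k} survives. *)
Lemma covariant_combination (I : finType) (c1 c2 c3 c4 b b1 b2 d : R)
    (N p1 p2 p3 p4 s t u h1 h2 : I -> R) :
  \sum_r N r * p1 r = b ->
  b1 - \sum_r N r * p2 r - \sum_r s r * u r = 0 ->
  b2 - \sum_r N r * p3 r - \sum_r t r * u r = 0 ->
  c1 * b + c2 * b1 + c3 * b2 + c4 * d
    - \sum_r N r * (c1 * p1 r + c2 * p2 r + c3 * p3 r + c4 * p4 r)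
    - \sum_r s r * (c2 * u r + c4 * h1 r)
    - \sum_r t r * (c3 * u r + c4 * h2 r) =
  c4 * (d - \sum_r N r * p4 r - \sum_r s r * h1 r - \sum_r t r * h2 r).
Proof.
move=> <- /subr0_eq E1 /subr0_eq E2.
have -> : b1 = \sum_r s r * u r + \sum_r N r * p2 r by rewrite -E1 subrK.
have -> : b2 = \sum_r t r * u r + \sum_r N r * p3 r by rewrite -E2 subrK.
have -> : \sum_r N r * (c1 * p1 r + c2 * p2 r + c3 * p3 r + c4 * p4 r) =
    c1 * (\sum_r N r * p1 r) + c2 * (\sum_r N r * p2 r) +
    c3 * (\sum_r N r * p3 r) + c4 * \sum_r N r * p4 r.
  by rewrite !mulr_sumr -!big_split; apply: eq_bigr => r _ /=; ring.
have lin2 (f g h : I -> R) c c' : \sum_r f r * (c * g r + c' * h r) =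
    c * (\sum_r f r * g r) + c' * \sum_r f r * h r.
  by rewrite !mulr_sumr -!big_split; apply: eq_bigr => r _ /=; ring.
by rewrite !lin2; ring.
Qed.

End MetricAlgebra.

(** * One chart: F^m, its derivatives and the regular set *)

Section RegularChart.
Variables (R : realType) (n m' : nat) (a : 'rV[R]_n -> seq 'I_n -> R).
Local Notation m := m'.+2.
Variable U : set 'rV[R]_n.
Hypothesis oU : open U.
Hypothesis a_smooth : forall s : m.-tuple 'I_n, smooth_on U (fun x => a x s).
Hypothesis a_sym : forall x (s t : m.-tuple 'I_n),
  U x -> perm_eq s t -> a x s = a x t.
Implicit Types (x y : 'rV[R]_n) (i j k l p r : 'I_n).

(** On [U], [A] is F^m, [H1 i] is h_i and [H2 i j] is h_ij; [B l] and [B1 l i] are the derivatives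
    of [A] and [H1 i] along x^l. *)
Let da l x (s : seq 'I_n) : R := pderiv l (fun z => a z s) x.
Let A x y := pform (a x) m y.
Let H1 i x y := pform (a x \o cons i) m'.+1 y.
Let H2 i j x y := pform (a x \o cons i \o cons j) m' y.
Let B l x y := pform (da l x) m y.
Let B1 l i x y := pform (da l x \o cons i) m'.+1 y.
Let G r x y := spray m a r x y.
Let N r l x y := nonlinear_connection m a r l x y.
(* psi (F^m) = F^(2-m) *)
Let psi (t : R) := mroot m t ^+ 2 / t.

Lemma coef_form_sym x : U x -> form_sym (a x) m.
Proof.
move=> Ux s t ss st; have ts : size t = m by rewrite -(perm_size st).
move/eqP: ss; move/eqP: ts => ts ss.
exact: (a_sym (s := Tuple ss) (t := Tuple ts)).
Qed.

Lemma dcoef_form_sym x l : U x -> form_sym (da l x) m.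
Proof.
move=> Ux s t ss st; apply: pderiv_eq oU _ Ux => z /set_mem Uz.
exact: coef_form_sym.
Qed.

Lemma is_derive_coef x l s : U x -> size s = m ->
  is_derive x (delta_mx 0 l) (a^~ s) (da l x s).
Proof.
move=> Ux /eqP ss; have [_ /(_ l)[D _]] := a_smooth (Tuple ss) 1.
exact/derivableP/D.
Qed.

Lemma is_derive_A_x x y l : U x ->
  is_derive x (delta_mx 0 l) (fun z => A z y) (B l x y).
Proof.
move=> Ux; apply: is_derive_pform_coef => J.
by apply: is_derive_coef; rewrite ?size_tuple.
Qed.

Lemma is_derive_H1_x x y i l : U x ->
  is_derive x (delta_mx 0 l) (fun z => H1 i z y) (B1 l i x y).
Proof.
move=> Ux; apply: (@is_derive_pform_coef _ _ (fun z => a z \o cons i)) => J.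
by apply: is_derive_coef; rewrite /= ?size_tuple.
Qed.

Lemma is_derive_H2_x x y i j l : U x ->
  is_derive x (delta_mx 0 l) (fun z => H2 i j z y)
    (pform (da l x \o cons i \o cons j) m' y).
Proof.
move=> Ux.
apply: (@is_derive_pform_coef _ _ (fun z => a z \o cons i \o cons j)) => J.
by apply: is_derive_coef; rewrite /= ?size_tuple.
Qed.

Lemma is_derive_A_y x y l : U x ->
  is_derive y (delta_mx 0 l) (A x) (m%:R * H1 l x y).
Proof. by move=> Ux; apply/is_derive_pform_delta/coef_form_sym. Qed.

Lemma is_derive_H1_y x y i l : U x ->
  is_derive y (delta_mx 0 l) (H1 i x) (m'.+1%:R * H2 i l x y).
Proof.
by move=> Ux; apply/is_derive_pform_delta/form_sym_cons/coef_form_sym.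
Qed.

(** The degree m-2 may be 0, where the derivative formula for forms of positive degree does not
    apply; smoothness of polynomials gives existence. *)
Lemma derivable_H2_y x y i j l : derivable (H2 i j x) y (delta_mx 0 l).
Proof.
have [_ /(_ l)[D _]] := class_C_pform (a x \o cons i \o cons j) m' 1 (@openT _).
exact: D.
Qed.

Lemma is_derive_B_y x y l i : U x ->
  is_derive y (delta_mx 0 i) (B l x) (m%:R * B1 l i x y).
Proof. by move=> Ux; apply/is_derive_pform_delta/dcoef_form_sym. Qed.

Lemma H2_sym i j x y : U x -> H2 i j x y = H2 j i x y.
Proof. by move=> Ux; exact/pform_swap/coef_form_sym. Qed.

Lemma H1E i x y : U x -> H1 i x y = \sum_j y 0 j * H2 j i x y.
Proof.
by move=> Ux; rewrite [LHS]pformS; apply: eq_bigr => j _; rewrite H2_sym.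
Qed.

(** A form of positive degree vanishes at y = 0, so regularity is a condition on F^m alone, and the
    regular set is the preimage of an open set. *)
Lemma regular_iff x y :
  regular m a x y <-> (if odd m then A x y != 0 else 0 < A x y).
Proof.
split=> [[]//|Ay]; split=> //; apply: contraTneq Ay => ->.
rewrite (_ : A x 0 = 0); first by rewrite eqxx ltxx; case: (odd m).
by rewrite /A pformS big1// => i _; rewrite mxE mul0r.
Qed.

Let cond := [set t : R | if odd m then t != 0 else 0 < t].

Lemma open_cond : open cond.
Proof. by rewrite /cond; case: (odd m); [exact: open_neq|exact: open_gt]. Qed.

Lemma regular_neq0 x y : regular m a x y -> A x y != 0.
Proof. by move/regular_iff; case: (odd m) => // /lt0r_neq0. Qed.

Let reg x := [set y | regular m a x y].

Lemma open_reg x : open (reg x).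
Proof.
rewrite (_ : reg x = A x @^-1` cond); last first.
  by apply/seteqP; split=> y /= /regular_iff.
apply: open_comp open_cond => y _.
have [cA _] := class_C_pform (a x) m 0 (@openT _).
by apply: cA; rewrite in_setT.
Qed.

Lemma near_regular x y : U x -> regular m a x y ->
  \forall z \near x, U z /\ regular m a z y.
Proof.
move=> Ux /regular_iff Axy.
have cA : {for x, continuous (fun z => A z y)}.
  have [cA _] : class_C 0 U (fun z => A z y).
    apply: class_C_bigsum => // J; apply: class_C_mul => //.
      exact: a_smooth.
    exact: class_C_cst.
  exact/cA/mem_set.
have nU := open_nbhs_nbhs (conj oU Ux).
have nA : nbhs x ((fun z => A z y) @^-1` cond).
  by apply: cA; exact: (open_nbhs_nbhs (conj open_cond Axy)).
by apply: filterS2 nU nA => z Uz /= ?; split=> //; exact/regular_iff.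
Qed.

(** * The contracted gamma symbols, the metric g and the invertibility of h *)

Lemma gammaE p x y :
  \sum_(J : m.-tuple 'I_n) gamma a p J x * \prod_(j <- J) y 0 j =
  (m%:R * m'.+1%:R)^-1 * (m%:R * (\sum_j y 0 j * B1 j p x y) - B p x y).
Proof.
have -> : B p x y = pform (da p x) m y by [].
rewrite /gamma subn1 /=.
under eq_bigr do rewrite -mulrA mulrBl mulr_suml.
rewrite -mulr_sumr sumrB exchange_big /=; congr (_ * (_ - _)).
(* In [f] the first index is the one differentiated along; the k-th cyclic term is [f] at the
   rotated tuple, because the monomial in y is invariant under rotation. *)
pose f (J : seq 'I_n) :=
  (if J is j :: J' then da j x (p :: J') else 0) * \prod_(j <- J) y 0 j.
have rotf (k : 'I_m) (J : m.-tuple 'I_n) :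
    pderiv (tnth J k) (fun z => a z (p :: behead (rot k J))) x *
      \prod_(j <- J) y 0 j = f (rot_tuple k J).
  have kJ : (k < size J)%N by rewrite size_tuple.
  rewrite /f /= (perm_big (rot k J)) /=; last by rewrite perm_sym perm_rot.
  by rewrite /rot (drop_nth (tnth J k) kJ) /= -tnth_nth.
under eq_bigr => k _ do under eq_bigr => J _ do rewrite rotf.
(* Rotation permutes the tuples, so the m cyclic terms contribute equally. *)
have sumf (k : 'I_m) : \sum_(J : m.-tuple 'I_n) f (rot_tuple k J) =
    \sum_(J : m.-tuple 'I_n) f J.
  rewrite [RHS](reindex_inj (h := fun J => rot_tuple k J)) //.
  by move=> J J' /(congr1 val) /rot_inj /val_inj.
under eq_bigr do rewrite sumf.
rewrite sumr_const card_ord [RHS]mulr_natl; congr (_ *+ _).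
rewrite (big_tupleS _ f); apply: eq_bigr => j _; rewrite mulr_sumr.
by apply: eq_bigr => J _; rewrite /f big_cons mulrCA.
Qed.

Lemma hmetricE x y i j : hmetric m a x y i j = H2 i j x y.
Proof. by rewrite mxE /H2 /pform subn2. Qed.

Lemma is_derive_F2 x y j : U x -> regular m a x y ->
  is_derive y (delta_mx 0 j) (fun z => mrootF m a x z ^+ 2)
    (2 * (H1 j x y * psi (A x y))).
Proof.
move=> Ux Vy; have m0 : 2 + m'%:R != 0 :> R by rewrite -natrD pnatr_eq0.
have D := is_derive_chain (is_derive_mroot_sqr m (regular_neq0 Vy))
  (is_derive_A_y y j Ux).
apply: is_derive_eq D _; rewrite -/(psi _); field.
exact: m0.
Qed.

Lemma gmetricE x y i j : U x -> regular m a x y ->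
  gmetric m a x y i j =
  (2 - m%:R) * (psi (A x y) / A x y) * (H1 i x y * H1 j x y)
  + m'.+1%:R * psi (A x y) * H2 i j x y.
Proof.
move=> Ux Vy; have m0 : 2 + m'%:R != 0 :> R by rewrite -natrD pnatr_eq0.
have A0 := regular_neq0 Vy.
rewrite mxE.
(* The first derivative is known on the whole regular set, which is open, so its formula may be
   differentiated again. *)
rewrite (pderiv_eq (U := reg x) (g := fun y => 2 * (H1 j x y * psi (A x y))))//;
  last 2 first.
- exact: open_reg.
- by move=> z /set_mem Vz; have [_ <-] := is_derive_F2 j Ux Vz.
have D := is_derive_chain (is_derive_mroot_sqr_div (ltn0Sn m'.+1) A0)
  (is_derive_A_y y i Ux).
have [_ DF] := is_derive_scale 2 (is_derive_mul (is_derive_H1_y y j i Ux) D).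
rewrite [pderiv _ _ _]DF.
rewrite -/(psi _) (H2_sym i j y Ux); field.
by rewrite A0 m0.
Qed.

Hypothesis g_unit : forall x y,
  U x -> regular m a x y -> gmetric m a x y \in unitmx.

Lemma h_unit x y : U x -> regular m a x y -> hmetric m a x y \in unitmx.
Proof.
move=> Ux Vy; have := g_unit Ux Vy.
set h := hmetric m a x y; set t := psi (A x y).
have hy i : (h *m y^T) i 0 = H1 i x y.
  rewrite mxE H1E//; apply: eq_bigr => j _.
  by rewrite hmetricE mxE mulrC H2_sym.
have yh j : (y *m h) 0 j = H1 j x y.
  by rewrite mxE H1E//; apply: eq_bigr => i _; rewrite hmetricE.
(* By symmetry both h y and y h have the entries h_i, so the rank-one term is h y^T (y h) and h
   factors out on the left. *)
have -> : gmetric m a x y = h *m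
    (((2 - m%:R) * (t / A x y)) *: (y^T *m (y *m h)) + (m'.+1%:R * t)%:M).
  apply/matrixP => i j.
  rewrite gmetricE// -hmetricE mulmxDr -scalemxAr mul_mx_scalar.
  rewrite [h *m (_ *m _)]mulmxA [RHS]mxE; congr (_ + _); rewrite [RHS]mxE//.
  by rewrite [in RHS]mxE big_ord1 hy yh.
by rewrite unitmx_mul => /andP[].
Qed.

(** * The spray: smoothness in y and its defining equation *)

Lemma class_C_spray x (e : nat) r : U x -> class_C e (reg x) (G r x).
Proof.
move=> Ux; have oV := @open_reg x.
apply: class_C_mul => //; first exact: class_C_cst.
apply: class_C_bigsum => // p; apply: class_C_mul => //.
  apply: class_C_invmx => // [y Vy|i j]; first exact: h_unit.
  rewrite (_ : (fun y => _) = H2 i j x); first exact: class_C_pform.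
  by apply: funext => y; rewrite hmetricE.
apply: class_C_bigsum => // J; apply: class_C_mul => //.
  exact: class_C_cst.
by apply: class_C_bigprod => // j; exact: class_C_coord.
Qed.

Lemma spray_eq x y p : U x -> regular m a x y ->
  \sum_r H2 p r x y * (2 * G r x y) =
  (m%:R * m'.+1%:R)^-1 * (m%:R * (\sum_j y 0 j * B1 j p x y) - B p x y).
Proof.
move=> Ux Vy; rewrite -gammaE.
pose c := \col_q \sum_(J : m.-tuple 'I_n) gamma a q J x * \prod_(j <- J) y 0 j.
have := congr1 (fun X : 'cV_n => X p 0) (mulKVmx (h_unit Ux Vy) c).
rewrite !mxE => <-; apply: eq_bigr => r _; rewrite hmetricE; congr (_ * _).
rewrite /G /spray mulrA divff ?pnatr_eq0// mul1r mxE.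
by apply: eq_bigr => q _; rewrite mxE.
Qed.

(** Contracting [B1 j p] with y^p gives [B j], so both parts of the gamma term become multiples of T
    = y^j B_j, and m T - T cancels the factor m-1. *)
Lemma spray_contracted x y : U x -> regular m a x y ->
  \sum_r H1 r x y * (2 * G r x y) = m%:R^-1 * \sum_j y 0 j * B j x y.
Proof.
move=> Ux Vy.
have -> : \sum_r H1 r x y * (2 * G r x y) =
    \sum_p y 0 p * \sum_r H2 p r x y * (2 * G r x y).
  under [RHS]eq_bigr do rewrite mulr_sumr.
  rewrite exchange_big; apply: eq_bigr => r _.
  by rewrite H1E// mulr_suml; apply: eq_bigr => p _; rewrite -mulrA.
under eq_bigr do rewrite spray_eq// mulrCA mulrBr.
rewrite -mulr_sumr sumrB.
have -> : \sum_p y 0 p * (m%:R * \sum_j y 0 j * B1 j p x y) =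
    m%:R * \sum_j y 0 j * B j x y.
  under eq_bigr do rewrite mulrCA mulr_sumr.
  rewrite -mulr_sumr exchange_big; congr (_ * _); apply: eq_bigr => j _ /=.
  rewrite /B pformS mulr_sumr; apply: eq_bigr => p _.
  by rewrite mulrCA.
have -> (T : R) : m%:R * T - T = m'.+1%:R * T.
  by rewrite -[m%:R]natr1 mulrDl mul1r addrK.
rewrite mulrA; congr (_ * _).
by rewrite invfM -mulrA mulVf ?mulr1// pnatr_eq0.
Qed.

(** * Vanishing horizontal derivatives of F^m and h_i *)

Lemma is_derive_unique_in V f g y v (d e : R) : open V -> {in V, f =1 g} ->
  V y -> is_derive y v f d -> is_derive (y : 'rV[R]_n) v g e -> d = e.
Proof.
move=> oV fg Vy fd [_ <-].
by have [_ ->] := is_derive_eq_in oV fg Vy fd.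
Qed.

(** [pderiv] is total, so smoothness of the spray is what makes [N] a genuine derivative of [G]. *)
Lemma is_derive_spray x y r l : U x -> regular m a x y ->
  is_derive y (delta_mx 0 l) (G r x) (N r l x y).
Proof.
move=> Ux Vy; have [_ /(_ l)[D _]] := class_C_spray 1 r Ux.
exact/derivableP/D.
Qed.

Lemma is_derive_connection x y r l i : U x -> regular m a x y ->
  is_derive y (delta_mx 0 i) (N r l x) (berwald m a r i l x y).
Proof.
move=> Ux Vy; have [_ /(_ l)[_ [_ /(_ i)[D _]]]] := class_C_spray 2 r Ux.
exact/derivableP/D.
Qed.

(** This is delta_l F^m = 0, as m h_r is the derivative of F^m along y^r. It comes from
    differentiating the contracted spray equation along y^l. *)
Lemma delta_mform x y l : U x -> regular m a x y ->
  \sum_r N r l x y * (m%:R * H1 r x y) = B l x y.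
Proof.
move=> Ux Vy.
have m0 : 2 + m'%:R != 0 :> R by rewrite -natrD pnatr_eq0.
have m10 : 1 + m'%:R != 0 :> R by rewrite nat1r pnatr_eq0.
have DL : is_derive y (delta_mx 0 l) (fun y => \sum_r H1 r x y * (2 * G r x y))
    (\sum_r (H1 r x y * (2 * N r l x y) +
      2 * G r x y * (m'.+1%:R * H2 r l x y))).
  apply: is_derive_bigsum => r; apply: is_derive_mul.
    exact: is_derive_H1_y.
  by apply: is_derive_scale; exact: is_derive_spray.
have DR : is_derive y (delta_mx 0 l) (fun y => m%:R^-1 * \sum_j y 0 j * B j x y)
    (m%:R^-1 * \sum_j (y 0 j * (m%:R * B1 j l x y) +
      B j x y * (delta_mx 0 l : 'rV[R]_n) 0 j)).
  apply/is_derive_scale/is_derive_bigsum => j; apply: is_derive_mul.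
    exact: is_derive_coord.
  exact: is_derive_B_y.
have := is_derive_unique_in (@open_reg x) _ Vy DL DR.
move=> /(_ (fun y Vy => spray_contracted Ux (set_mem Vy))).
rewrite !big_split /=.
under [X in _ * (_ + X)]eq_bigr do rewrite mulrC.
rewrite sum_delta_mx.
have -> : \sum_r 2 * G r x y * (m'.+1%:R * H2 r l x y) =
    m'.+1%:R * \sum_r H2 l r x y * (2 * G r x y).
  rewrite mulr_sumr; apply: eq_bigr => r _.
  by rewrite (H2_sym _ _ _ Ux); ring.
(* The uncontracted equation eliminates the undifferentiated [G]; the terms y^j [B1 j l] then
   cancel, leaving 2/m times [B l]. *)
rewrite spray_eq//.
have -> : \sum_j y 0 j * (m%:R * B1 j l x y) = m%:R * \sum_j y 0 j * B1 j l x y.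
  by rewrite mulr_sumr; apply: eq_bigr => j _; rewrite mulrCA.
have -> : \sum_r H1 r x y * (2 * N r l x y) =
    2 / m%:R * \sum_r N r l x y * (m%:R * H1 r x y).
  rewrite mulr_sumr; apply: eq_bigr => r _; field.
  exact: m0.
set S := \sum_r N r l x y * _; set T := \sum_j y 0 j * _.
move/(canRL (addrK _)) => E.
have -> : S = m%:R / 2 * (2 / m%:R * S) by field; rewrite m0.
by rewrite E; field; rewrite m0 m10.
Qed.

(* h_{i|k} = 0 for h_i = H1 i; the factor m - 1 comes from dh_i/dy^r. *)
Lemma hcov_H1 x y i k : U x -> regular m a x y ->
  B1 k i x y - \sum_r N r k x y * (m'.+1%:R * H2 i r x y)
    - \sum_r berwald m a r i k x y * H1 r x y = 0.
Proof.
move=> Ux Vy.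
have m0 : 2 + m'%:R != 0 :> R by rewrite -natrD pnatr_eq0.
(* The identity delta_k F^m = 0 is differentiated along y^i, which turns [N] into the Berwald
   coefficients. *)
have DL : is_derive y (delta_mx 0 i)
    (fun y => \sum_r N r k x y * (m%:R * H1 r x y))
    (\sum_r (N r k x y * (m%:R * (m'.+1%:R * H2 r i x y)) +
      m%:R * H1 r x y * berwald m a r i k x y)).
  apply: is_derive_bigsum => r; apply: is_derive_mul.
    exact: is_derive_connection.
  by apply: is_derive_scale; exact: is_derive_H1_y.
have := is_derive_unique_in (@open_reg x) _ Vy DL (is_derive_B_y y k i Ux).
move=> /(_ (fun y Vy => delta_mform k Ux (set_mem Vy))) E.
have -> : B1 k i x y = m%:R^-1 * (m%:R * B1 k i x y).
  by rewrite mulKf// pnatr_eq0.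
rewrite -E mulr_sumr -!sumrB big1// => r _.
by rewrite (H2_sym i r _ Ux); field.
Qed.

(** * Comparison of the covariant derivatives of g and h *)

Lemma hcov_gmetric x y i j k : U x -> regular m a x y ->
  hcov m a (gmetric m a) i j k x y =
  m'.+1%:R * psi (A x y) * hcov m a (hmetric m a) i j k x y.
Proof.
move=> Ux Vy; have A0 := regular_neq0 Vy.
pose chi t := psi t / t.
have psiD : derivable psi (A x y) 1.
  by have [] := is_derive_mroot_sqr_div (ltn0Sn m'.+1) A0.
have chiD : derivable chi (A x y) 1 :=
  derivable_mroot_sqr_div2 (ltn0Sn m'.+1) A0.
(* The coefficient of h_r in g_rp and g_pr: it also multiplies the derivative of the other h-factor
   in the product rule, which makes the Berwald terms match. *)
pose c2 p := (2 - m%:R) * chi (A x y) * H1 p x y.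
have gE p q : gmetric m a x y p q =
    c2 q * H1 p x y + m'.+1%:R * psi (A x y) * hmetric m a x y p q.
  rewrite gmetricE// hmetricE /c2 [H1 p x y * _]mulrC.
  by congr (_ + _); rewrite mulrA.
have nx : \forall z \near x, (2 - m%:R) * chi (A z y) * (H1 i z y * H1 j z y) +
    m'.+1%:R * psi (A z y) * H2 i j z y = gmetric m a z y i j.
  have := near_regular Ux Vy.
  by apply: filterS => z [Uz Vz]; rewrite gmetricE.
have ny : \forall w \near y, (2 - m%:R) * chi (A x w) * (H1 i x w * H1 j x w) +
    m'.+1%:R * psi (A x w) * H2 i j x w = gmetric m a x w i j.
  apply: near_eq_in (@open_reg x) _ Vy => w /set_mem Vw.
  by rewrite gmetricE.
have Dx : pderiv k (fun z => gmetric m a z y i j) x = _ :=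
  derive_metric nx chiD psiD (is_derive_A_x y k Ux)
    (is_derive_H1_x y i k Ux) (is_derive_H1_x y j k Ux)
    (is_derive_H2_x y i j k Ux).
have Dy r : pderiv r (fun w => gmetric m a x w i j) y = _ :=
  derive_metric ny chiD psiD (is_derive_A_y y r Ux)
    (is_derive_H1_y y i r Ux) (is_derive_H1_y y j r Ux)
    (derivableP (@derivable_H2_y x y i j r)).
have hE : (fun z w => hmetric m a z w i j) = H2 i j.
  by apply/funext => z; apply/funext => w; exact: hmetricE.
have gri r : gmetric m a x y i r =
    c2 i * H1 r x y + m'.+1%:R * psi (A x y) * hmetric m a x y i r.
  rewrite gmetricE// hmetricE /c2.
  by congr (_ + _); rewrite mulrA.
have [_ DH] := is_derive_H2_x y i j k Ux.
rewrite /hcov hE /delta_deriv Dx [pderiv k _ x]DH.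
under eq_bigr do rewrite Dy.
under [X in _ - X - _ = _]eq_bigr do rewrite gE.
under [X in _ - X = _]eq_bigr do rewrite gri.
exact: covariant_combination (delta_mform k Ux Vy) (hcov_H1 i k Ux Vy)
  (hcov_H1 j k Ux Vy).
Qed.

Lemma hcov_gmetric_eq0 x y i j k : U x -> regular m a x y ->
  hcov m a (gmetric m a) i j k x y = 0 <->
  hcov m a (hmetric m a) i j k x y = 0.
Proof.
move=> Ux Vy; rewrite hcov_gmetric//.
have A0 := regular_neq0 Vy.
have c0 : m'.+1%:R * psi (A x y) != 0.
  rewrite mulf_neq0 ?pnatr_eq0//.
  by rewrite mulf_neq0 ?invr_eq0// expf_neq0// mroot_neq0.
by split=> [/eqP|->]; rewrite ?mulr0// mulf_eq0 (negbTE c0) => /eqP.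
Qed.

End RegularChart.

(** * From a single chart to the whole space *)

Theorem theorem6 (R : realType) (n m : nat) (hm : (2 <= m)%N)
    (M : smoothManifold R n) (S : mthRootSpace m M) :
  landsberg S <->
  (forall (c : chart_index M) (x y : 'rV[R]_n),
     chart_img (atlas c) x -> regular m (coef S c) x y ->
     forall i j k : 'I_n,
       hcov m (coef S c) (hmetric m (coef S c)) i j k x y = 0%R).
Proof.
case: m hm S => [|[|m']] // _ S.
have E c x y i j k : chart_img (atlas c) x -> regular m'.+2 (coef S c) x y ->
    hcov m'.+2 (coef S c) (gmetric m'.+2 (coef S c)) i j k x y = 0 <->
    hcov m'.+2 (coef S c) (hmetric m'.+2 (coef S c)) i j k x y = 0.
  apply: hcov_gmetric_eq0.
  - exact: chart_img_open.
  - exact: coef_smooth.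
  - by move=> z s t; exact: coef_sym.
  - exact: g_nondegenerate.
split=> H c x y Ux Vy i j k; have [gh hg] := E c x y i j k Ux Vy.
  exact: (gh (H c x y Ux Vy i j k)).
exact: (hg (H c x y Ux Vy i j k)).
Qed.
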